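(* Let $k\ge 2$ and let $G_1,\ldots,G_k$ be graphs on $n_1,\ldots,n_k \ge 1$ vertices, respectively, where $G_i$ is path-pairable for every $i\le k-1$. Let $n=\sum_{i=1}^k n_i$ and let $u_i=\sum_{j=1}^i n_j$ for $i=1,\dots,k-1$. Then the blown-up path $P_k(G_1,\ldots,G_k)$ is path-pairable if and only if $$n_i\cdot n_{i+1}\ \ge\ \min(u_i,\,n-u_i)$$ holds for all $i=1,\ldots,k-1$.
   Context: All graphs are finite, simple and undirected. For a nonnegative integer $\ell$, a graph $G$ on at least $2\ell$ vertices is $\ell$-path-pairable if for any pair of disjoint sets of distinct vertices $\{x_1,\dots,x_\ell\}$ and $\{y_1,\dots,y_\ell\}$ of $G$ there exist $\ell$ pairwise edge-disjoint paths $Q_1,\dots,Q_\ell$ in $G$ such that $Q_i$ is a path from $x_i$ to $y_i$ for each $1\le i\le \ell$. An $\ell$-path-pairable graph on $2\ell$ or $2\ell+1$ vertices is called path-pairable (in particular, the one-vertex graph is trivially path-pairable, with $\ell=0$). $P_k$ denotes the path on $k$ vertices $v_1,\dots,v_k$ (in this order along the path). For a graph $G$ with vertex set $\{v_1,\ldots,v_k\}$ and graphs $G_1,\ldots,G_k$, the blown-up graph $G(G_1,\ldots,G_k)$ is obtained by replacing every vertex $v_i$ of $G$ by the graph $G_i$ (on pairwise disjoint vertex sets) and, for every edge $v_iv_j\in E(G)$, inserting a complete bipartite graph between the vertex sets of $G_i$ and $G_j$. Thus $P_k(G_1,\ldots,G_k)$ consists of disjoint copies of $G_1,\ldots,G_k$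 together with all edges between $V(G_i)$ and $V(G_{i+1})$ for $1\le i\le k-1$. *)

(* Defs.v *)
From HB Require Import structures.
From mathcomp Require Import all_boot.

Set Implicit Arguments.
Unset Strict Implicit.
Unset Printing Implicit Defensive.

Record sgraph := SGraph {
  vertex :> finType;
  edge : rel vertex;
  edge_sym : symmetric edge;
  edge_irrefl : irreflexive edge
}.

(* As in path.v, a nonempty vertex sequence is given as its head x and its
   tail p.  A path in a graph does not repeat vertices, hence uniq. *)
Definition is_path (G : sgraph) (x y : G) (p : seq G) : bool :=
  [&& path (@edge G) x p, last x p == y & uniq (x :: p)].

(* Edges are unordered pairs, so that a path and its reverse have the same
   edges. *)
Definition path_edges (G : sgraph) (x : G) (p : seq G) : {set {set G}} :=
  [set:: pairmap (fun a b => [set a; b]) x p].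

Definition l_path_pairable (l : nat) (G : sgraph) : Prop :=
  l.*2 <= #|G| /\
  forall x y : 'I_l -> G,
    injective x -> injective y -> (forall i j, x i <> y j) ->
    exists Q : 'I_l -> seq G,
      (forall i, is_path (x i) (y i) (Q i)) /\
      (forall i j, i <> j ->
         [disjoint path_edges (x i) (Q i) & path_edges (x j) (Q j)]).

Definition path_pairable (G : sgraph) : Prop :=
  exists l : nat,
    (#|G| = l.*2 \/ #|G| = l.*2.+1) /\ l_path_pairable l G.

Definition path_edge (k : nat) : rel 'I_k :=
  fun i j => (i.+1 == j) || (j.+1 == i).

Lemma path_edge_sym k : symmetric (@path_edge k).
Proof. by move=> i j; rewrite /path_edge orbC. Qed.

Lemma path_edge_irrefl k : irreflexive (@path_edge k).
Proof. by move=> i; rewrite /path_edge orbb -[in RHS](ltnn i) eqn_leq ltnn. Qed.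

(* The path on k vertices (not of length k); the vertex v_i is i - 1 in 'I_k. *)
Definition path_graph (k : nat) : sgraph :=
  SGraph (@path_edge_sym k) (@path_edge_irrefl k).

Section Blowup.
Variables (H : sgraph) (G : H -> sgraph).

(* When tag u == tag v, tagged_as u v is the vertex of v, cast to the graph
   G (tag u) containing the vertex of u. *)
Definition blowup_edge : rel {i : H & G i} :=
  fun u v => edge (tag u) (tag v)
    || (tag u == tag v) && edge (tagged u) (tagged_as u v).

Lemma blowup_edge_sym : symmetric blowup_edge.
Proof.
move=> [i a] [j b]; rewrite /blowup_edge /= edge_sym [j == i]eq_sym.
case: eqVneq => //= eij; case: _ / eij b => b.
by rewrite !tagged_asE edge_sym.
Qed.

Lemma blowup_edge_irrefl : irreflexive blowup_edge.
Proof. by move=> [i a]; rewrite /blowup_edge /= tagged_asE !edge_irrefl andbF. Qed.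

Definition blowup : sgraph := SGraph blowup_edge_sym blowup_edge_irrefl.
End Blowup.
Arguments blowup : clear implicits.

(* Main.v *)
Require Import Defs.
From mathcomp Require Import all_boot.
From mathcomp Require Import zify.

(** Necessity is a cut argument. The vertices in the first [i] classes form one
    side of a cut with [n_i * n_(i+1)] edges, and one can ask for
    [min (u_i, N - u_i)] paths across it ([path_pairable_cut]).

    For sufficiency, orient every pair upwards and build all paths at the same
    time, class by class. By the hypothesis the number of pairs that must cross
    from class [i] to class [i+1] is at most [n_i * n_(i+1)]. If at most
    [n_(i+1)] paths stand on each vertex of class [i], the paths on a common
    vertex can all leave it by distinct edges, those that end in class [i+1]
    going straight to their ends. What has to be maintained is the bound on the
    number of paths per vertex. On average it holds, so it suffices to balance
    the positions of the paths in class [i+1]. There are two ways to do so: a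
    path that only passes through class [i+1] can enter it at another vertex,
    and a path that starts in class [i+1] can first walk, inside that class, to
    a vertex at which some path ends. The walks of the second kind, together
    with the pairs that lie inside class [i+1], form a pairing of vertices of
    the class, which its path-pairability turns into edge-disjoint paths. A
    distribution of the paths with the least total excess over the bound has no
    excess, for otherwise one of the two modifications would improve it
    ([excess_improve], [balanced_spread]).

    All paths that enter the last class end there, at their own ends. The edges
    from the class before to the other vertices of the last class are therefore
    free, and the pairs inside the last class are joined over them. *)

Set Implicit Arguments.
Unset Strict Implicit.
Unset Printing Implicit Defensive.

(** * Edge-disjoint routings *)

Lemma path_pairmap (T : Type) (U : eqType) (e : T -> T -> U) x p (s : seq U) :
  {subset pairmap e x p <= s} -> path (fun a b => e a b \in s) x p.
Proof.
elim: p x => //= b p IH x sub; rewrite sub ?mem_head //= IH // => z zp.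
by rewrite sub // inE zp orbT.
Qed.

Section Routing.
Variable G : sgraph.

(** Edge-disjoint path systems are handled through the edges that each pair may
    use, given as symmetric relations [E p] no two of which share an edge. The
    paths themselves, and their simplicity, need not be tracked: connectivity
    is enough, because a walk contains a path. *)
Definition routing (P : finType) (R : {set P}) (x y : P -> G)
    (E : P -> rel G) : Prop :=
  [/\ forall p, symmetric (E p),
      forall p, subrel (E p) (@edge G),
      forall p q a b, E p a b -> E q a b -> p = q &
      {in R, forall p, connect (E p) (x p) (y p)}].

Lemma set2_inj (a b c d : G) :
  [set a; b] = [set c; d] -> a = c /\ b = d \/ a = d /\ b = c.
Proof.
move=> e.
have: a \in [set c; d] by rewrite -e set21.
have: b \in [set c; d] by rewrite -e set22.
have: c \in [set a; b] by rewrite e set21.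
have: d \in [set a; b] by rewrite e set22.
rewrite !inE => /pred2P[]-> /pred2P[]? /pred2P[]? /pred2P[]?; subst; by intuition.
Qed.

Lemma path_edgesP (r : rel G) x p e :
  path r x p -> e \in path_edges x p -> exists a b, r a b /\ e = [set a; b].
Proof.
rewrite inE; elim: p x => //= b p IH x /andP[rxb rp].
by rewrite inE => /predU1P[->|/(IH _ rp)//]; exists x, b.
Qed.

Lemma routing_paths (P : finType) (x y : P -> G) E :
  routing setT x y E ->
  exists Q : P -> seq G,
    (forall p, is_path (x p) (y p) (Q p)) /\
    (forall p q, p <> q ->
       [disjoint path_edges (x p) (Q p) & path_edges (x q) (Q q)]).
Proof.
move=> [Esym Eedge Einj Econ].
have path_in p : exists s, is_path (x p) (y p) s && path (E p) (x p) s.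
  have /connectP[s sP yE] := Econ p (in_setT p).
  case: (shortenP sP) yE => s' s'P s'u _ yE; exists s'.
  by rewrite s'P andbT; apply/and3P; rewrite (sub_path (Eedge p) s'P) -yE.
have [Q QP] := fin_all_exists path_in.
exists Q; split=> [p|p q pq]; first by case/andP: (QP p).
rewrite disjoint_subset; apply/subsetP=> e.
have /andP[_ Pp] := QP p; have /andP[_ Pq] := QP q.
move=> /(path_edgesP Pp)[a [b [Eab ->]]]; rewrite inE; apply/negP.
move=> /(path_edgesP Pq)[c [d [Ecd /set2_inj[[ac bd]|[ad bc]]]]]; apply: pq.
  by apply: (Einj p q a b) => //; rewrite ac bd.
by apply: (Einj p q a b) => //; rewrite ad bc Esym.
Qed.

Lemma is_path_connect x y p :
  is_path x y p ->
  connect [rel a b : G | edge a b && ([set a; b] \in path_edges x p)] x y.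
Proof.
case/and3P=> xp /eqP<- _; apply/connectP; exists p => //.
rewrite path_relI xp /=.
have := @path_pairmap _ _ (fun a b => [set a; b]) x p _ (fun e => id).
rewrite (eq_path (e' := [rel a b : G | [set a; b] \in path_edges x p])) //.
by move=> a b; rewrite /= inE.
Qed.

(** Path-pairability only speaks of [l] pairs that cover the graph up to one
    vertex, but any smaller family of pairs can be completed to such a
    pairing. The vertices outside of the family are listed as [rest], and the
    two halves of an initial segment of [rest] are matched to each other. *)
Lemma path_pairable_routing (P : finType) (R : {set P}) (x y : P -> G) :
    path_pairable G ->
    {in R &, injective x} -> {in R &, injective y} ->
    {in R &, forall p q, x p != y q} ->
  exists E, routing R x y E.
Proof.
move=> [l [card_G [_ link]]] x_inj y_inj xy_neq.
have [R0|[p0 p0R]] := set_0Vmem R.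
  exists (fun _ _ _ => false); split=> // p; by rewrite R0 inE.
pose r := enum R.
pose used := map x r ++ map y r.
have used_uniq : uniq used.
  rewrite cat_uniq !map_inj_in_uniq ?enum_uniq //=; last first.
  - by move=> p q; rewrite !mem_enum; apply: x_inj.
  - by move=> p q; rewrite !mem_enum; apply: y_inj.
  rewrite andbT; apply/hasPn => _ /mapP[q qR ->]; apply/negP => /mapP[p pR e].
  by move: (xy_neq p q); rewrite -!(mem_enum R) pR qR e eqxx => /(_ isT isT).
pose rest := enum [predC used].
have size_used : size used = #|R| + #|R| by rewrite size_cat !size_map -cardE.
have size_rest : #|R| + #|R| + size rest = #|G|.
  by rewrite -size_used -(card_uniqP used_uniq) -cardE cardC.
pose m := l - #|R|.
pose sx := map x r ++ take m rest.
pose sy := map y r ++ take m (drop m rest).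
have le_Rl : #|R| <= l by lia.
have size_sx : size sx = l.
  by rewrite size_cat size_map -cardE size_takel //; lia.
have size_sy : size sy = l.
  by rewrite size_cat size_map -cardE size_takel // ?size_drop; lia.
have sxy_uniq : uniq (sx ++ sy).
  have /perm_uniq-> : perm_eq (sx ++ sy) (used ++ take (m + m) rest).
    by rewrite takeD /sx /sy /used -!catA perm_cat2l perm_catCA.
  rewrite cat_uniq used_uniq take_uniq ?enum_uniq // andbT.
  apply/hasPn => v /mem_take.
  by rewrite mem_enum.
have [sx_uniq disj sy_uniq] :
    [/\ uniq sx, {in sy, forall v, v \notin sx} & uniq sy].
  by move: sxy_uniq; rewrite cat_uniq => /and3P[-> /hasPn ? ->].
have [|||Q [QP Qdis]] :=
    link (fun i => nth (x p0) sx i) (fun i => nth (x p0) sy i).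
- by move=> i j /eqP; rewrite nth_uniq ?size_sx // => /eqP/val_inj.
- by move=> i j /eqP; rewrite nth_uniq ?size_sy // => /eqP/val_inj.
- move=> i j e; have := disj (nth (x p0) sy j).
  by rewrite -e !mem_nth ?size_sx ?e ?mem_nth ?size_sy // => /(_ isT).
have lt_r p : p \in R -> index p r < l.
  by move=> pR; apply: leq_trans le_Rl; rewrite cardE index_mem mem_enum.
pose idx p (pR : p \in R) := Ordinal (lt_r p pR).
(* Pair [p] of the family is pair number [index p r] of the completed one. *)
exists (fun p a b => edge a b && [exists i : 'I_l, [&& p \in R, i == index p r :> nat
  & [set a; b] \in path_edges (nth (x p0) sx i) (Q i)]]).
split=> [p a b|p a b /andP[]//|p q a b|p pR].
- by rewrite edge_sym setUC.
- case/andP=> _ /existsP[i /and3P[pR /eqP ip ei]].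
  case/andP=> _ /existsP[j /and3P[qR /eqP jq ej]].
  have ij : i = j.
    apply/eqP/negPn/negP => /eqP/Qdis.
    by rewrite disjoint_subset => /subsetP/(_ _ ei); rewrite inE ej.
  by rewrite -(nth_index p0 (s := r) (x := p)) ?mem_enum // -ip ij jq nth_index ?mem_enum.
- have := is_path_connect (QP (idx p pR)).
  have pr : index p r < size r by rewrite index_mem mem_enum.
  have ex : nth (x p0) sx (idx p pR) = x p.
    by rewrite nth_cat size_map pr (nth_map p0) ?nth_index ?mem_enum.
  have -> : nth (x p0) sy (idx p pR) = y p.
    by rewrite nth_cat size_map pr (nth_map p0) ?nth_index ?mem_enum.
  rewrite -[in X in _ -> X]ex; apply: connect_sub => a b /andP[ab e].
  apply/connect1.
  by rewrite /= ab; apply/existsP; exists (idx p pR); rewrite pR eqxx.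
Qed.

End Routing.

(** * Cuts *)

Lemma connect_exit (T : finType) (r : rel T) (A : {set T}) x y :
  connect r x y -> x \in A -> y \notin A -> exists2 e : T * T,
    (e.1 \in A) && (e.2 \notin A) & r e.1 e.2.
Proof.
case/connectP=> p; elim: p x => [x _ -> ->//|b p IH x /= /andP[rxb bp] yE xA yA].
have [bA|bA] := boolP (b \in A); first exact: IH bp yE bA yA.
by exists (x, b); rewrite /= ?xA.
Qed.

(** If as many pairs as possible are chosen with their ends on the two sides of
    a cut, then each of their paths uses an edge of the cut of its own. *)
Lemma path_pairable_cut (G : sgraph) (A : {set G}) : path_pairable G ->
  minn #|A| #|~: A|
    <= #|[set e : G * G | [&& e.1 \in A, e.2 \notin A & edge e.1 e.2]]|.
Proof.
move=> ppG; set m := minn _ _.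
pose x (i : 'I_m) := enum_val (widen_ord (geq_minl _ _) i : 'I_#|A|).
pose y (i : 'I_m) := enum_val (widen_ord (geq_minr _ _) i : 'I_#|~: A|).
have xA i : x i \in A by apply: enum_valP.
have yA i : y i \notin A by rewrite -in_setC; apply: enum_valP.
have [|||E [_ Eedge Einj Econ]] :=
    path_pairable_routing (R := [set: 'I_m]) (x := x) (y := y) ppG.
- by move=> i j _ _ /enum_val_inj [] /ord_inj.
- by move=> i j _ _ /enum_val_inj [] /ord_inj.
- by move=> i j _ _; apply: contraNneq (yA j) => <-.
have exit i : exists e : G * G, (e.1 \in A) && (e.2 \notin A) && E i e.1 e.2.
  have [e eA Ee] := connect_exit (Econ i (in_setT i)) (xA i) (yA i).
  by exists e; rewrite eA.
have [f fP] := fin_all_exists exit.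
have f_inj : injective f.
  move=> i j fij; have /andP[_ Ei] := fP i; have /andP[_ Ej] := fP j.
  by apply: Einj Ei _; rewrite fij.
rewrite -[m in m <= _]card_ord -(card_imset _ f_inj); apply/subset_leq_card/subsetP.
move=> _ /imsetP[i _ ->]; have /andP[/andP[eA eB] Ei] := fP i.
by rewrite inE eA eB (Eedge i).
Qed.

Lemma routing_path_pairable (G : sgraph) :
    (forall (l : nat) (x y : 'I_l -> G), injective x -> injective y ->
       (forall i j, x i != y j) -> exists E, routing setT x y E) ->
  path_pairable G.
Proof.
move=> route; exists #|G|./2; split; first by lia.
split=> [|x y x_inj y_inj xy]; first by lia.
have [|E /routing_paths//] := route _ x y x_inj y_inj.
by move=> i j; apply/eqP/xy.
Qed.

(** * Balanced passage to the next layer *)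

(** Passage from one layer to the next. The pairs in [C] have a path that has
    reached [pos p] in the current layer and must enter the next layer [Y]. The
    pairs in [D] end there, at [t p]; the pairs in [S] start there, at [s p].
    The pairs that go on beyond [Y] are those of [(C :\: D) :|: S], and they
    can be continued if at most [c] of them stand on each vertex of [Y], where
    [c] is the size of the layer after [Y]. *)
Section Spread.
Variables (P B : finType) (C D S : {set P}) (Y : {set B}).
Variables (pos s t : P -> B) (c : nat).
Hypothesis sDC : D \subset C.
Hypothesis disCS : [disjoint C & S].
Hypothesis t_inj : {in D &, injective t}.
Hypothesis tY : {in D, forall p, t p \in Y}.
Hypothesis s_inj : {in S &, injective s}.
Hypothesis sY : {in S, forall p, s p \in Y}.
Hypothesis fibre : forall v, #|[set p in C | pos p == v]| <= #|Y|.
Hypothesis room : #|(C :\: D) :|: S| <= #|Y| * c.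

(** A vertex where a path ends is left by one path fewer than those entering it,
    and a vertex where a path starts by one more. To even this out, a starting
    path may first move to a vertex of [t @: D]; distinct starting paths have
    distinct positions, so these moves form a pairing of vertices of [Y], which
    path-pairability inside the layer can realise. *)
Definition spread (w : P -> B) : Prop :=
  [/\ {in C :|: S, forall p, w p \in Y},
      {in D, w =1 t},
      {in C &, forall p q, pos p = pos q -> w p = w q -> p = q},
      {in S &, injective w} &
      {in S, forall p, w p = s p \/ w p \in t @: D}].

Definition load (w : P -> B) y := \sum_(p in (C :\: D) :|: S) (w p == y).

Definition excess w := \sum_(y in Y) (load w y - c).

Definition redirect (w : P -> B) p y q := if q == p then y else w q.

(** The paths standing on a common vertex [v] number at most [#|Y|], so those
    that do not end in [Y] can be injected into the vertices of [Y] that the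
    ending ones leave free. *)
Lemma exists_spread : exists w, spread w.
Proof.
pose F v := [set p in C | pos p == v].
pose free v := enum (Y :\: t @: (D :&: F v)).
pose r v := enum (F v :\: D).
pose w p := if p \in S then s p else if p \in D then t p else
  nth (pos p) (free (pos p)) (index p (r (pos p))).
have lt_free p : p \in C -> p \notin D -> index p (r (pos p)) < size (free (pos p)).
  move=> pC pD.
  have: index p (r (pos p)) < #|F (pos p) :\: D|.
    by rewrite cardE index_mem mem_enum !inE pD pC /=.
  have := fibre (pos p); rewrite -/(F _) -cardE cardsD => le_FY lt_i.
  have sub : t @: (D :&: F (pos p)) \subset Y.
    by apply/subsetP => _ /imsetP[q /setIP[qD _] ->]; apply: tY.
  rewrite cardsD (setIidPr sub) card_in_imset; last first.
    by move=> q q' /setIP[qD _] /setIP[q'D _]; apply: t_inj.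
  move: lt_i; rewrite setIC => lt_i; have := subset_leq_card (subsetIl D (F (pos p))).
  lia.
have nS p : p \in C -> (p \in S) = false by move=> pC; apply: (disjointFr disCS).
have wfree p : p \in C -> p \notin D -> w p \in Y :\: t @: (D :&: F (pos p)).
  move=> pC pD; rewrite /w nS // (negPf pD) -mem_enum.
  by apply: mem_nth; apply: lt_free.
have wD p : p \in D -> w p = t p.
  by move=> pD; rewrite /w pD nS // (subsetP sDC).
exists w; split=> //.
- move=> p /setUP[pC|pS]; last by rewrite /w pS sY.
  have [pD|pD] := boolP (p \in D); first by rewrite wD ?tY.
  by have /setDP[] := wfree p pC pD.
- move=> p q pC qC epos.
  have [pD|pD] := boolP (p \in D); have [qD|qD] := boolP (q \in D).
  + by rewrite !wD //; apply: t_inj.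
  + have /setDP[_ /imsetP nt] := wfree q qC qD.
    rewrite (wD p) // => e; case: nt; exists p => //.
    by rewrite !inE pD pC epos /=.
  + have /setDP[_ /imsetP nt] := wfree p pC pD.
    rewrite (wD q) // => e; case: nt; exists q => //.
    by rewrite !inE qD qC epos /=.
  + rewrite /w !nS // (negPf pD) (negPf qD) -epos => /eqP.
    rewrite nth_uniq ?enum_uniq ?lt_free //; last by rewrite epos lt_free.
    have pr : p \in r (pos p) by rewrite mem_enum !inE pD pC /=.
    have qr : q \in r (pos p) by rewrite mem_enum !inE qD qC epos /=.
    by move=> /eqP e; rewrite -(nth_index p pr) e nth_index.
- by move=> p q pS qS; rewrite /w pS qS; apply: s_inj.
- by move=> p pS; left; rewrite /w pS.
Qed.

Lemma load_redirect w p y z : p \in (C :\: D) :|: S ->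
  load (redirect w p y) z + (w p == z) = load w z + (y == z).
Proof.
move=> pM; rewrite /load !(bigD1 p pM) /= {1}/redirect eqxx.
rewrite (eq_bigr (fun q => nat_of_bool (w q == z))); first by lia.
by move=> q /andP[_ qp]; rewrite /redirect (negPf qp).
Qed.

Lemma excess_redirect w p y' : p \in (C :\: D) :|: S ->
    w p \in Y -> c < load w (w p) -> load w y' < c ->
  excess (redirect w p y') < excess w.
Proof.
move=> pM wpY over under; rewrite /excess !(bigD1 (w p) wpY) /= -addSn.
apply: leq_add.
  have := load_redirect w y' (w p) pM.
  have -> : (y' == w p) = false by apply/eqP => e; move: under; rewrite e; lia.
  by rewrite eqxx; lia.
apply: leq_sum => z /andP[_ zp].
have := load_redirect w y' z pM; rewrite eq_sym (negPf zp).
by case: eqP => [<-|_]; lia.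
Qed.

Lemma sum_load w : spread w -> \sum_(y in Y) load w y <= #|Y| * c.
Proof.
case=> wY _ _ _ _; apply: leq_trans room.
rewrite exchange_big -sum1_card /=; apply: leq_sum => p pM.
have pY : w p \in Y.
  by apply: wY; move: pM; rewrite !inE; case/orP=> [/andP[_ ->]|->]; rewrite ?orbT.
rewrite (bigD1 (w p)) //= eqxx big1 // => y /andP[_].
by rewrite eq_sym; case: eqP.
Qed.

Lemma underloaded w y : spread w -> y \in Y -> c < load w y ->
  exists2 y', y' \in Y & load w y' < c.
Proof.
move=> ws yY over; apply/exists_inP; apply: contraLR over.
rewrite negb_exists_in => /forall_inP full; rewrite -leqNgt.
have := sum_load ws; rewrite (bigD1 y) //= (cardD1 y) yY mulnDl mul1n.
suff: #|[predD1 Y & y]| * c <= \sum_(i in Y | i != y) load w i by lia.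
rewrite -sum_nat_const; under eq_bigl => i do rewrite !inE andbC.
by apply: leq_sum => i /andP[iY _]; rewrite leqNgt full.
Qed.

Lemma loadE w y :
  load w y = #|[set p in C :\: D | w p == y]| + #|[set p in S | w p == y]|.
Proof.
have sum_card (A : {set P}) : \sum_(p in A) (w p == y) = #|[set p in A | w p == y]|.
  by rewrite -sum1dep_card big_mkcondr; apply: eq_bigr => p _; case: eqP.
rewrite -!sum_card -bigU; first by apply: eq_bigl => p; rewrite !inE.
exact: disjointWl (subsetDl C D) disCS.
Qed.

Lemma card_fibre_le1 (A : {set P}) (f : P -> B) y :
  {in A &, injective f} -> #|[set p in A | f p == y]| <= 1.
Proof.
move=> f_inj; apply/card_le1P => p; rewrite inE => /andP[pA /eqP fp] q.
rewrite !inE; apply/andP/eqP => [[qA /eqP fq]|->]; last by rewrite fp eqxx.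
by apply: f_inj; rewrite ?fp.
Qed.

Lemma redirect_passing w p y' : spread w -> y' \in Y -> p \in C :\: D ->
    pos p \notin pos @: [set q in C | w q == y'] -> spread (redirect w p y').
Proof.
move=> [wY wD w_inj wS_inj wS] y'Y /setDP[pC pD] pos_p.
have new q : q \in C -> pos p = pos q -> w q <> y'.
  by move=> qC e wq; case/imsetP: pos_p; exists q; rewrite // inE qC wq /=.
have nSp q : q \in S -> (q == p) = false.
  by move=> qS; apply: contraTF qS => /eqP->; rewrite (disjointFr disCS pC).
split=> [q qM|q qD|q q' qC q'C|q q' qS q'S|q qS]; rewrite /redirect.
- by case: ifP => // _; apply: wY.
- by case: eqP => [e|_]; [rewrite e (negPf pD) in qD | apply: wD].
- case: eqP => [->|_]; case: eqP => [->|_] //.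
  + by move=> e /esym/new; case.
  + by move=> e /new; case.
  + exact: w_inj.
- by rewrite !nSp //; apply: wS_inj.
- by rewrite nSp //; apply: wS.
Qed.

Lemma redirect_starting w p y' : spread w -> y' \in Y -> p \in S ->
    y' \in t @: D -> y' \notin w @: S -> spread (redirect w p y').
Proof.
move=> [wY wD w_inj wS_inj wS] y'Y pS y't y'w.
have nCp q : q \in C -> (q == p) = false.
  by move=> qC; apply: contraTF pS => /eqP<-; rewrite (disjointFr disCS qC).
have new q : q \in S -> w q <> y'.
  by move=> qS wq; case/imsetP: y'w; exists q.
split=> [q qM|q qD|q q' qC q'C|q q' qS q'S|q qS]; rewrite /redirect.
- by case: ifP => // _; apply: wY.
- by rewrite nCp ?wD // (subsetP sDC).
- by rewrite !nCp //; apply: w_inj.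
- case: eqP => [->|_]; case: eqP => [->|_] //.
  + by move=> /esym/new; case.
  + by move=> /new; case.
  + exact: wS_inj.
- by case: eqP => [_|_]; [right | apply: wS].
Qed.

(** Passing paths at [y] occupy distinct vertices of the previous layer, as do
    the paths entering [y']. If the former are more numerous, one of them comes
    from a vertex none of whose paths enters [y'], and it can enter [y']
    instead. *)
Lemma exists_passing w y y' : spread w -> load w y' + 2 <= load w y ->
    #|[set p in S | w p == y]| + #|[set p in D | t p == y']|
      < #|[set p in S | w p == y']| + 2 ->
  exists p, [/\ p \in C :\: D, w p = y &
                pos p \notin pos @: [set q in C | w q == y']].
Proof.
move=> [_ wD w_inj _ _] gap small; rewrite !loadE in gap.
set head := [set p in C :\: D | w p == y] in gap *.
set there := [set q in C | w q == y'].
have pos_inj z : {in [set q in C | w q == z] &, injective pos}.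
  move=> p q; rewrite !inE => /andP[pC /eqP wp] /andP[qC /eqP wq] e.
  by apply: w_inj; rewrite ?wp.
have le_there :
    #|there| <= #|[set p in C :\: D | w p == y']| + #|[set p in D | t p == y']|.
  apply: leq_trans (leq_card_setU _ _); apply/subset_leq_card/subsetP=> q.
  rewrite !inE; have [qD|qD] := boolP (q \in D); last by rewrite orbF.
  by rewrite wD // => /andP[_ ->].
have card_pos : #|pos @: there| < #|pos @: head|.
  have head_inj : {in head &, injective pos}.
    apply: sub_in2 (pos_inj y) => p; rewrite !inE.
    by case/andP=> /andP[_ ->].
  have -> : #|pos @: head| = #|head| := card_in_imset head_inj.
  have -> : #|pos @: there| = #|there| := card_in_imset (pos_inj y').
  lia.
have /subsetPn[_ /imsetP[p pH ->] new] : ~~ (pos @: head \subset pos @: there).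
  by apply: contraTN card_pos => /subset_leq_card; rewrite -leqNgt.
by move: pH; rewrite inE => /andP[pM /eqP wp]; exists p.
Qed.

(** Some load being above [c], another one is below [c], so two loads differ by
    at least two. The only obstacle to redirecting a passing path from [y] to
    [y'] arises when a starting path stands on [y], some path ends at [y'], and
    no starting path has moved to [y']: then the starting path itself can
    move. *)
Lemma excess_improve w : spread w -> excess w != 0 ->
  exists2 w', spread w' & excess w' < excess w.
Proof.
move=> ws; rewrite /excess sum_nat_eq0 negb_forall_in => /exists_inP[y yY].
rewrite subn_eq0 -ltnNge => over.
have [y' y'Y under] := underloaded ws yY over.
have [_ _ _ wS_inj _] := ws.
have yS := card_fibre_le1 y wS_inj; have y'D := card_fibre_le1 y' t_inj.
case: (ltnP (#|[set p in S | w p == y]| + #|[set p in D | t p == y']|)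
            (#|[set p in S | w p == y']| + 2)) => [small|large].
  have [|p [pM wp pos_p]] := exists_passing ws _ small; first by lia.
  exists (redirect w p y'); first exact: redirect_passing.
  by apply: excess_redirect; rewrite ?wp // inE pM.
have /card_gt0P[p] : 0 < #|[set p in S | w p == y]| by lia.
rewrite inE => /andP[pS /eqP wp].
have /card_gt0P[q] : 0 < #|[set p in D | t p == y']| by lia.
rewrite inE => /andP[qD /eqP tq].
exists (redirect w p y').
  apply: redirect_starting => //; first by rewrite -tq imset_f.
  apply/imsetP => -[p' p'S wp'].
  suff : 0 < #|[set p in S | w p == y']| by lia.
  by apply/card_gt0P; exists p'; rewrite inE p'S wp' /=.
by apply: excess_redirect; rewrite ?wp // inE pS orbT.
Qed.

Lemma balanced_spread :
  exists2 w, spread w & {in Y, forall y, #|[set p in (C :\: D) :|: S | w p == y]| <= c}.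
Proof.
have [w0 ws0] := exists_spread.
have [m] := ubnP (excess w0).
elim: m w0 ws0 => // m IH w ws; rewrite ltnS => le_m.
have [ex0|/(excess_improve ws)[w' ws' lt]] := eqVneq (excess w) 0; last first.
  by apply: (IH w') => //; lia.
exists w => // y yY.
move/eqP: ex0; rewrite /excess sum_nat_eq0 => /forall_inP/(_ y yY).
rewrite subn_eq0 loadE; apply: leq_trans.
apply: leq_trans (leq_card_setU _ _); apply/subset_leq_card/subsetP=> q.
by rewrite !inE; case/andP=> /orP[]-> ->; rewrite ?orbT.
Qed.

End Spread.

(** * Sweeping through the layers *)

(** Iteration of the passage over all layers. [crossing j] consists of the pairs
    whose path must use an edge between the layers [j] and [j.+1]; there are
    enough of these edges by the hypothesis [room_between]. *)
Section Sweep.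
Variables (P B : finType) (lev : B -> nat) (s t : P -> B).

Definition layer j := [set v | lev v == j].
Definition crossing j := [set p | lev (s p) <= j < lev (t p)].
Definition starting j := [set p | lev (s p) == j & j < lev (t p)].
Definition ending j := [set p | lev (s p) < j & lev (t p) == j].

(** Positions from which the paths of [crossing j] can leave layer [j]. The load
    bound allows the paths on one vertex to enter distinct vertices of layer
    [j.+1]; the last two clauses say that the moves of the starting paths
    inside the layer form a pairing. *)
Definition admissible j (f : P -> B) : Prop :=
  [/\ {in crossing j, forall p, lev (f p) = j},
      forall v, #|[set p in crossing j | f p == v]| <= #|layer j.+1|,
      {in starting j &, injective f} &
      {in starting j, forall p, f p = s p \/ f p \in t @: ending j}].

(** The path of [p] goes along the edge from [f p] to [g p], so the first clause
    makes the paths edge-disjoint between the two layers. *)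
Definition advance j (f g : P -> B) : Prop :=
  {in crossing j &, forall p q, f p = f q -> g p = g q -> p = q} /\
  {in ending j.+1, g =1 t}.

Hypothesis s_inj : injective s.
Hypothesis t_inj : injective t.
Hypothesis room_between : forall j, #|crossing j| <= #|layer j| * #|layer j.+1|.

Lemma crossingS j :
  crossing j.+1 = (crossing j :\: ending j.+1) :|: starting j.+1.
Proof. by apply/setP => p; rewrite !inE; lia. Qed.

Lemma admissible0 : admissible 0 s.
Proof.
split=> [p|v|p q _ _|p _]; [ | | exact: s_inj | by left].
  by rewrite inE => /andP[]; rewrite leqn0 => /eqP.
have le1 : #|[set p in crossing 0 | s p == v]| <= 1.
  by apply: card_fibre_le1 => p q _ _; apply: s_inj.
have [->//|/card_gt0P[p]] := posnP #|[set p in crossing 0 | s p == v]|.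
rewrite inE => /andP[p0 _].
apply: leq_trans le1 _; rewrite lt0n; apply: contraL (room_between 0) => /eqP->.
by rewrite muln0 -ltnNge; apply/card_gt0P; exists p.
Qed.

Lemma sweep_step j f : admissible j f ->
  exists2 g, admissible j.+1 g & advance j f g.
Proof.
case=> f_lev f_fibre f_inj f_start.
have [||||||||w [wY wD w_inj wS_inj wS] w_load] := @balanced_spread P B
    (crossing j) (ending j.+1) (starting j.+1) (layer j.+1) f s t #|layer j.+2|.
- by apply/subsetP => p; rewrite !inE; lia.
- by rewrite disjoint_subset; apply/subsetP => p; rewrite !inE; lia.
- by move=> p q _ _; apply: t_inj.
- by move=> p; rewrite !inE => /andP[].
- by move=> p q _ _; apply: s_inj.
- by move=> p; rewrite !inE => /andP[].
- exact: f_fibre.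
- by rewrite -crossingS.
rewrite -crossingS in w_load.
have w_lev : {in crossing j.+1, forall p, w p \in layer j.+1}.
  by move=> p pC; apply: wY; move: pC; rewrite !inE; lia.
exists w => //; split=> // [p /w_lev|v]; first by rewrite inE => /eqP.
have [->//|/card_gt0P[p]] := posnP #|[set p in crossing j.+1 | w p == v]|.
by rewrite inE => /andP[/w_lev pY /eqP<-]; apply: w_load.
Qed.

Lemma sweep m : exists pos : nat -> P -> B, forall j, j <= m ->
  admissible j (pos j) /\ advance j (pos j) (pos j.+1).
Proof.
suff [pos posP] : exists pos : nat -> P -> B, forall j, j <= m.+1 ->
    admissible j (pos j) /\ (0 < j -> advance j.-1 (pos j.-1) (pos j)).
  exists pos => j le_jm; split; first by case: (posP j (leqW le_jm)).
  by have [_] := posP j.+1 le_jm; apply.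
elim: m.+1 => {m} [|m [pos posP]].
  by exists (fun _ => s) => j; rewrite leqn0 => /eqP->; split=> //; apply: admissible0.
have [g g_adm g_adv] := sweep_step (posP m (leqnn m)).1.
exists (fun j => if j == m.+1 then g else pos j) => j le_j.
have [->|ne_j] := eqVneq j m.+1; first by rewrite /= ltn_eqF.
have [j_adm j_adv] := posP j (ltac:(lia)).
by split=> // j0; rewrite ifN; [ exact: j_adv | lia].
Qed.

End Sweep.

(** * Routing in layered graphs *)

(** From the positions to a routing, in a graph whose consecutive layers are
    completely joined and whose layers other than the last one, [K], route
    every pairing of their vertices. The vertex [z] lies in the layer before the
    last one and serves the pairs inside the last layer. *)
Section Layered.
Variables (G : sgraph) (lev : G -> nat) (K : nat).
Variables (P : finType) (s t : P -> G) (z : G).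

Definition layer_linked j := forall (R : {set P}) (x y : P -> G),
  {in R, forall p, lev (x p) = j} -> {in R, forall p, lev (y p) = j} ->
  {in R &, injective x} -> {in R &, injective y} ->
  {in R &, forall p q, x p != y q} ->
  exists2 E, routing R x y E & forall p a b, E p a b -> lev a = j /\ lev b = j.

Hypothesis lev_le : forall v, lev v <= K.
Hypothesis lev_z : (lev z).+1 = K.
Hypothesis edge_up : forall u v, lev v = (lev u).+1 -> edge u v.
Hypothesis linked : forall j, j < K -> layer_linked j.
Hypothesis s_inj : injective s.
Hypothesis t_inj : injective t.
Hypothesis s_neq_t : forall p q, s p != t q.
Hypothesis s_le_t : forall p, lev (s p) <= lev (t p).

Section Assemble.
Variable pos : nat -> P -> G.
Hypothesis pos_adm : forall j, j <= K -> admissible lev s t j (pos j).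
Hypothesis pos_adv : forall j, j <= K -> advance lev s t j (pos j) (pos j.+1).

(** The point to which the path of [p] leads inside the layer of [s p], before it
    climbs: the end of [p] if it lies in that layer, and otherwise the position
    of [p] when leaving the layer. *)
Definition inner_end p := if lev (s p) == lev (t p) then t p else pos (lev (s p)) p.
Definition moving j := [set p | lev (s p) == j & inner_end p != s p].

Lemma lev_inner_end p : lev (inner_end p) = lev (s p).
Proof.
rewrite /inner_end; case: eqP => [//|ne].
have [pos_lev _ _ _] := pos_adm (lev_le (s p)).
by apply: pos_lev; rewrite inE leqnn /=; have := s_le_t p; lia.
Qed.

Lemma inner_end_internal p : lev (s p) = lev (t p) -> inner_end p = t p.
Proof. by rewrite /inner_end => ->; rewrite eqxx. Qed.

Lemma inner_end_starting p : lev (s p) < lev (t p) -> inner_end p = pos (lev (s p)) p.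
Proof. by rewrite /inner_end => lt; rewrite ltn_eqF. Qed.

Lemma inner_end_starting_target p : lev (s p) < lev (t p) -> inner_end p != s p ->
  exists2 q, inner_end p = t q & lev (s q) < lev (t q).
Proof.
move=> lt; rewrite (inner_end_starting lt).
have [_ _ _ start] := pos_adm (lev_le (s p)).
have pS : p \in starting lev s t (lev (s p)) by rewrite inE eqxx.
case: (start p pS) => [->|/imsetP[q]]; first by rewrite eqxx.
by rewrite inE => /andP[ltq /eqP e] -> _; exists q; rewrite ?e.
Qed.

Lemma inner_end_target p : inner_end p != s p -> exists q, inner_end p = t q.
Proof.
have := s_le_t p; rewrite leq_eqVlt => /predU1P[/inner_end_internal->|lt mp].
  by exists p.
by have [q e _] := inner_end_starting_target lt mp; exists q.
Qed.

(** A starting path only moves to the end of a path that comes from an earlier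
    layer, never to the end of a path that stays in the layer. *)
Lemma inner_end_inj j : {in moving j &, injective inner_end}.
Proof.
move=> p q; rewrite !inE => /andP[/eqP pj mp] /andP[/eqP qj mq].
have := s_le_t p; rewrite leq_eqVlt => /predU1P[ep|ltp];
have := s_le_t q; rewrite leq_eqVlt => /predU1P[eq|ltq].
- by rewrite !inner_end_internal //; apply: t_inj.
- rewrite (inner_end_internal ep); have [r -> ltr] := inner_end_starting_target ltq mq.
  by move=> /t_inj pr; move: ltr; rewrite -pr ep ltnn.
- rewrite (inner_end_internal eq); have [r -> ltr] := inner_end_starting_target ltp mp.
  by move=> /t_inj rq; move: ltr; rewrite rq eq ltnn.
- rewrite !inner_end_starting // pj qj.
  have [|_ _ pos_inj _] := pos_adm (j := j); first by rewrite -pj.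
  by apply: pos_inj; rewrite inE ?pj ?qj eqxx /= -1?{1}pj -1?{1}qj; lia.
Qed.

Lemma moving_routing j : j < K ->
  exists2 E, routing (moving j) s inner_end E &
             forall p a b, E p a b -> lev a = j /\ lev b = j.
Proof.
move=> ltjK; apply: linked => //.
- by move=> p; rewrite inE => /andP[/eqP].
- by move=> p; rewrite inE lev_inner_end => /andP[/eqP].
- by move=> p q _ _; apply: s_inj.
- exact: inner_end_inj.
- move=> p q _; rewrite inE => /andP[_ /inner_end_target[r ->]]; exact: s_neq_t.
Qed.

(** The edges from a layer to the next one that [p] uses, oriented upwards.
    Inside the last layer a pair is joined by a detour through [z]. The edges
    of the detour are free: among the edges into the last layer, the other
    pairs use only those that enter their own ends. *)
Definition rise p : rel G := fun u v =>
  [&& p \in crossing lev s t (lev u), u == pos (lev u) p & v == pos (lev u).+1 p]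
  || [&& lev (s p) == K, u == z & (v == s p) || (v == t p)].

Lemma lev_pos_next j p : j < K -> p \in crossing lev s t j -> lev (pos j.+1 p) = j.+1.
Proof.
move=> ltj pC; have [e|ne] := eqVneq (lev (t p)) j.+1.
  have [_ ->] // := pos_adv (ltnW ltj).
  by move: pC; rewrite !inE e eqxx ltnS andbT => /andP[].
have [pos_lev _ _ _] := pos_adm ltj.
by apply: pos_lev; move: pC ne; rewrite !inE; lia.
Qed.

Lemma rise_lev p u v : rise p u v -> lev v = (lev u).+1.
Proof.
case/orP=> [/and3P[pC _ /eqP->]|/and3P[/eqP sK /eqP-> vE]].
  apply: lev_pos_next => //; have := lev_le (t p).
  by move: pC; rewrite inE; lia.
rewrite lev_z; have := s_le_t p; have := lev_le (t p).
by case/orP: vE => /eqP->; lia.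
Qed.

Lemma rise_last p u v : rise p u v -> (lev u).+1 = K -> v = s p \/ v = t p.
Proof.
case/orP=> [/and3P[pC _ /eqP-> uK]|/and3P[_ _ /orP[]/eqP->]];
  [right | by left | by right].
have [_ ->] // := pos_adv (lev_le u).
by move: pC; have := lev_le (t p); rewrite !inE; lia.
Qed.

Lemma ends_inj p q v : v = s p \/ v = t p -> v = s q \/ v = t q -> p = q.
Proof.
move=> [] -> [].
- exact: s_inj.
- by move/eqP; rewrite (negPf (s_neq_t _ _)).
- by move/esym/eqP; rewrite (negPf (s_neq_t _ _)).
- exact: t_inj.
Qed.

Lemma rise_inj p q u v : rise p u v -> rise q u v -> p = q.
Proof.
move=> pr qr; have [uK|uK] := eqVneq (lev u).+1 K.
  by apply: (@ends_inj p q v); apply: rise_last uK.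
have ne : (u == z) = false.
  by apply: contraNF uK => /eqP->; rewrite lev_z.
case/orP: pr => [|/and3P[_]]; rewrite ?ne //.
case/orP: qr => [|/and3P[_]]; rewrite ?ne //.
move=> /and3P[qC /eqP uq /eqP vq] /and3P[pC /eqP up /eqP vp].
have [pos_inj _] := pos_adv (lev_le u).
by apply: (pos_inj p q) => //; rewrite -?up -?vp.
Qed.

Lemma assemble : exists E, routing setT s t E.
Proof.
have F_ex (i : 'I_K) : exists Fi : P -> rel G,
    routing (moving i) s inner_end Fi /\
    forall p a b, Fi p a b -> lev a = i /\ lev b = i.
  by have [E] := moving_routing (ltn_ord i); exists E.
have [F FP] := fin_all_exists F_ex.
pose stay p a b := [exists i : 'I_K, F i p a b].
pose E p a b := [|| stay p a b, rise p a b | rise p b a].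
have stay_lev p a b : stay p a b -> lev a = lev b.
  by case/existsP=> i Fi; have [_ /(_ _ _ _ Fi)[-> ->]] := FP i.
have stay_sym p a b : stay p a b = stay p b a.
  by apply: eq_existsb => i; have [[Fsym _ _ _] _] := FP i; apply: Fsym.
have stay_inj p q a b : stay p a b -> stay q a b -> p = q.
  case/existsP=> i Fi /existsP[j Fj].
  have [[_ _ Finj _] Flev] := FP i; have [_ Flev'] := FP j.
  have ij : i = j.
    by apply: ord_inj; have [<- _] := Flev _ _ _ Fi; have [<- _] := Flev' _ _ _ Fj.
  by apply: (Finj p q a b) => //; rewrite ij.
have E_sym p : symmetric (E p).
  by move=> a b; rewrite /E stay_sym [rise p a b || _]orbC.
have E_up p a b : E p a b -> lev a < lev b -> rise p a b.
  by case/or3P=> [/stay_lev|//|/rise_lev]; lia.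
have E_flat p a b : E p a b -> lev a = lev b -> stay p a b.
  by case/or3P=> [//|/rise_lev|/rise_lev]; lia.
have E_rise p a b : rise p a b -> connect (E p) a b.
  by move=> r; apply: connect1; rewrite /E r orbT.
have E_inner p : lev (s p) < K -> connect (E p) (s p) (inner_end p).
  move=> ltK; have [->|mp] := eqVneq (inner_end p) (s p); first exact: connect0.
  have [[_ _ _ Fcon] _] := FP (Ordinal ltK).
  have := Fcon p; rewrite inE eqxx mp => /(_ isT).
  apply: connect_sub => a b Fab; apply: connect1; apply/orP; left.
  by apply/existsP; exists (Ordinal ltK).
exists E; split=> [//|p a b|p q a b|p _].
- case/or3P=> [/existsP[i Fi]|/rise_lev ab|/rise_lev ba].
  + by have [[_ Fedge _ _] _] := FP i; apply: Fedge Fi.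
  + exact: edge_up.
  + by rewrite edge_sym; apply: edge_up.
- case: (ltngtP (lev a) (lev b)) => lev_ab Ep Eq.
  + by apply: (@rise_inj p q a b); apply: E_up.
  + by apply: (@rise_inj p q b a); apply: E_up; rewrite // E_sym.
  + by apply: (stay_inj p q a b); apply: E_flat.
- have := s_le_t p; rewrite leq_eqVlt => /predU1P[e|lt].
    have := lev_le (s p); rewrite leq_eqVlt => /predU1P[sK|ltK]; last first.
      by have := E_inner p ltK; rewrite inner_end_internal.
    apply: (@connect_trans _ _ z).
      rewrite (sym_connect_sym (E_sym p)); apply: E_rise.
      by rewrite /rise sK !eqxx orbT.
    by apply: E_rise; rewrite /rise sK !eqxx !orbT.
  have E_pos d : lev (s p) + d < lev (t p) ->
      connect (E p) (s p) (pos (lev (s p) + d) p).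
    elim: d => [|d IH] ltd.
      rewrite addn0 -inner_end_starting //; apply: E_inner.
      exact: leq_trans lt (lev_le _).
    apply: connect_trans (IH _) _; first by lia.
    apply: E_rise; rewrite addnS; apply/orP; left.
    have [|pos_lev _ _ _] := pos_adm (j := lev (s p) + d).
      by have := lev_le (t p); lia.
    by rewrite pos_lev inE ?eqxx ?andbT; lia.
  pose d := (lev (t p)).-1 - lev (s p).
  have [|pos_lev _ _ _] := pos_adm (j := lev (s p) + d).
    by have := lev_le (t p); lia.
  have [|_ pos_t] := pos_adv (j := lev (s p) + d).
    by have := lev_le (t p); lia.
  apply: connect_trans (E_pos d _) _; first by lia.
  apply: E_rise; apply/orP; left.
  rewrite pos_lev ?inE; last by lia.
  rewrite pos_t ?inE ?eqxx; last by lia.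
  by rewrite !andbT; lia.
Qed.

End Assemble.

Lemma layered_routing :
    (forall j, #|crossing lev s t j| <= #|layer lev j| * #|layer lev j.+1|) ->
  exists E, routing setT s t E.
Proof.
move=> room_between; have [pos posP] := sweep s_inj t_inj room_between K.
by apply: (@assemble pos) => j /posP[].
Qed.

End Layered.

(** * Blown-up paths *)

Section BlowupPath.
Variables (k : nat) (G : 'I_k -> sgraph).
Notation B := (blowup (path_graph k) G).

Definition level (v : B) : nat := (tag v : 'I_k).

Lemma card_level (Q : pred 'I_k) :
  #|[set v : B | Q (tag v)]| = \sum_(i < k | Q i) #|G i|.
Proof.
rewrite cardsE -sum1_card.
transitivity (\sum_(i < k | Q i) \sum_(a : G i) 1).
  by rewrite sig_big_dep /=; apply: eq_bigl => v; rewrite andbT.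
by apply: eq_bigr => i _; rewrite sum1_card.
Qed.

Lemma card_layer (i : 'I_k) : #|layer level i| = #|G i|.
Proof.
transitivity #|[set v : B | tag v == i]|.
  by apply: eq_card => v; rewrite !inE.
by rewrite (card_level (pred1 i)) big_pred1_eq.
Qed.

Lemma level_edge (u v : B) : edge u v ->
  [\/ level u = level v, level v = (level u).+1 | level u = (level v).+1].
Proof.
case/orP=> [/orP[/eqP e|/eqP e]|/andP[/eqP e _]].
- by constructor 2; rewrite /level e.
- by constructor 3; rewrite /level e.
- by constructor 1; rewrite /level e.
Qed.

Lemma edge_level (u v : B) : level v = (level u).+1 -> edge u v.
Proof. by move=> e; apply/orP; left; apply/orP; left; apply/eqP; exact: esym e. Qed.

Lemma linked_layer (P : finType) (i : 'I_k) : 0 < #|G i| ->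
  path_pairable (G i) -> @layer_linked B level P i.
Proof.
case/card_gt0P=> d _ ppG R x y xi yi x_inj y_inj xy.
(* The default [d] only serves vertices of other layers. *)
pose proj (u : B) : G i := tagged_as (Tagged G d) u.
have projK (u : B) : level u = i -> Tagged G (proj u) = u.
  case: u => j a; rewrite /level /= => /ord_inj ji; case: _ / (esym ji) a => a.
  by rewrite /proj tagged_asE.
have [|||E [Esym Eedge Einj Econ]] := path_pairable_routing (R := R)
    (x := fun p => proj (x p)) (y := fun p => proj (y p)) ppG.
- move=> p q pR qR e; apply: x_inj => //.
  by rewrite -(projK (x p)) ?e ?projK ?xi.
- move=> p q pR qR e; apply: y_inj => //.
  by rewrite -(projK (y p)) ?e ?projK ?yi.
- move=> p q pR qR; apply: contraNneq (xy p q pR qR) => e.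
  by rewrite -(projK (x p)) ?e ?projK ?xi ?yi.
exists (fun p (u v : B) =>
    [&& level u == i, level v == i & E p (proj u) (proj v)]).
  split=> [p u v|p u v|p q u v|p pR].
  - by rewrite Esym andbCA.
  - case/and3P=> /eqP ui /eqP vi /Eedge.
    rewrite -(projK u ui) -(projK v vi) /proj !tagged_asE => uv.
    by apply/orP; right; rewrite /= eqxx tagged_asE.
  - by case/and3P=> _ _ Ep /and3P[_ _ Eq]; apply: Einj Ep Eq.
  - rewrite -(projK (x p)) ?xi // -(projK (y p)) ?yi //.
    have /connectP[s sP ->] := Econ p pR.
    elim: s (proj (x p)) sP => [|b s IH] a /=; first by rewrite connect0.
    case/andP=> ab /IH; apply: connect_trans; apply: connect1.
    by rewrite /level /proj /= !eqxx !tagged_asE.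
by move=> p u v /and3P[/eqP-> /eqP->].
Qed.

End BlowupPath.

Arguments level {k G} v.

Theorem lemma3 (k : nat) (hk : 2 <= k)
    (n : 'I_k -> nat) (hn : forall i : 'I_k, 1 <= n i)
    (G : 'I_k -> sgraph) (hG : forall i : 'I_k, #|G i| = n i)
    (hpp : forall i : 'I_k, i.+1 < k -> path_pairable (G i)) :
  let N := \sum_(j < k) n j in
  let u (i : 'I_k) := \sum_(j < k | j <= i) n j in
  path_pairable (blowup (path_graph k) G) <->
  forall i j : 'I_k, i.+1 = j :> nat ->
    n i * n j >= minn (u i) (N - u i).
Proof.
move=> N u; set B := blowup _ _.
pose below (i : nat) := [set v : B | level v <= i].
have card_below (i : 'I_k) : #|below i| = u i.
  by rewrite (card_level G (fun j => j <= i)); apply: eq_bigr => j _; apply: hG.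
have card_B : #|B| = N.
  rewrite -cardsT (card_level G predT); by apply: eq_bigr => j _; apply: hG.
have card_above (i : 'I_k) : #|~: below i| = N - u i.
  by rewrite cardsCs setCK card_below card_B.
split=> [ppB i j ij|cut].
  rewrite -card_above -card_below; apply: leq_trans (path_pairable_cut _ ppB) _.
  rewrite -!hG -!card_layer -cardsX; apply/subset_leq_card/subsetP=> e.
  rewrite !inE -ltnNge => /and3P[le_i lt_i /level_edge].
  by rewrite -ij; move: (level e.1) (level e.2) le_i lt_i => a b ? ? [] ?; lia.
apply: routing_path_pairable => l x y x_inj y_inj xy.
(* The paths are built upwards, so the lower end of each pair comes first. *)
pose s p := if level (x p) <= level (y p) then x p else y p.
pose t p := if level (x p) <= level (y p) then y p else x p.
have s_inj : injective s.
  move=> p q; rewrite /s.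
  do 2![case: ifP => _]; try by [apply: x_inj | apply: y_inj];
    by move/eqP; rewrite ?(negPf (xy _ _)) // eq_sym (negPf (xy _ _)).
have t_inj : injective t.
  move=> p q; rewrite /t.
  do 2![case: ifP => _]; try by [apply: x_inj | apply: y_inj];
    by move/eqP; rewrite ?(negPf (xy _ _)) // eq_sym (negPf (xy _ _)).
have s_neq_t p q : s p != t q.
  rewrite /s /t; have [<-|pq] := eqVneq p q; first by case: ifP; rewrite // eq_sym.
  by do 2![case: ifP => _];
    rewrite ?xy ?(inj_eq x_inj) ?(inj_eq y_inj) // eq_sym xy.
have s_le_t p : level (s p) <= level (t p).
  by rewrite /s /t; case: (leqP (level (x p))) => // /ltnW.
have lt_k (v : B) : level v < k by apply: ltn_ord.
have lt_k2 : k.-2 < k by lia.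
have /card_gt0P[z0 _] : 0 < #|G (Ordinal lt_k2)| by rewrite hG.
have room_between j : #|crossing level s t j|
    <= #|layer (@level k G) j| * #|layer (@level k G) j.+1|.
  case: (ltnP j.+1 k) => [ltj|lej]; last first.
    rewrite (_ : crossing _ _ _ _ = set0) ?cards0 //; apply/setP => p.
    by rewrite !inE; have := lt_k (t p); lia.
  have := cut (Ordinal (ltnW ltj)) (Ordinal ltj) erefl.
  rewrite -!hG -!card_layer /=; apply: leq_trans.
  rewrite -card_above -card_below leq_min -(card_imset _ s_inj); apply/andP; split.
    apply/subset_leq_card/subsetP=> _ /imsetP[p pC ->].
    by move: pC; rewrite !inE => /andP[].
  rewrite (card_imset _ s_inj) -(card_imset _ t_inj).
  apply/subset_leq_card/subsetP=> _ /imsetP[p pC ->].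
  by move: pC; rewrite !inE -ltnNge => /andP[].
have [|||||||||E [Esym Eedge Einj Econ]] :=
    @layered_routing B level k.-1 _ s t (Tagged G z0).
- by move=> v; have := lt_k v; lia.
- by rewrite /level /=; lia.
- exact: edge_level.
- move=> j ltj; have ltk : j < k by lia.
  by apply: (@linked_layer k G _ (Ordinal ltk)); rewrite ?hG //; apply: hpp => /=; lia.
- exact: s_inj.
- exact: t_inj.
- exact: s_neq_t.
- exact: s_le_t.
- exact: room_between.
exists E; split=> // p _; have := Econ p (in_setT p).
by rewrite /s /t; case: ifP => // _; rewrite (sym_connect_sym (Esym p)).
Qed.
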